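(* Let $p$ be a prime, let $n,k,l$ be positive integers with $l\mid k$, put $d=\gcd(n,k)$, $e=\gcd(n,l)$, $L=\operatorname{lcm}(d,l)$, and let $a\in\mathbb{F}_{p^n}$. Let $\delta\in \mathbb{F}_{p^n}^*$ and $\delta_1\in \mathbb{F}_{p^d}^*$ be any elements such that $T_d^n(\delta)=1$ and $T_e^d(\delta_1)=1$. 1. When $p\mid\frac{k}{L}$, there exists a solution in $\mathbb{F}_{p^n}$ to the equation $T_l^k(X)=a$ if and only if $T_d^n(a)=0$. In that case, $$x_0=S_l^{2l}\Bigl(\sum_{i=0}^{\frac{n}{d}-2}\sum_{j=i+1}^{\frac{n}{d}-1}\delta^{p^{kj}}a^{p^{ki}}\Bigr)$$ is a particular $\mathbb{F}_{p^n}$-solution to the equation $T_l^k(X)=a$. 2. When $p\nmid\frac{k}{L}$, there exists a solution in $\mathbb{F}_{p^n}$ to the equation $T_l^k(X)=a$ if and only if $S_e^{2e}\circ T_d^n(a)=0$. In that case, $$x_0=y_0+\frac{L}{k}\bigl(a-T_l^k(y_0)\bigr)\delta_1,\qquad\text{where}\qquad y_0=\sum_{i=0}^{\frac{n}{d}-2}\sum_{j=i+1}^{\frac{n}{d}-1}\delta^{p^{kj}}\bigl(S_l^{2l}(a)\bigr)^{p^{ki}},$$ is a particular $\mathbb{F}_{p^n}$-solution to the equation $T_l^k(X)=a$.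
   Context: For positive integers $u\mid v$ and a prime $p$, define the linearized polynomials $T_u^v(X)=\sum_{i=0}^{v/u-1}X^{p^{ui}}$ and $S_u^v(X)=\sum_{i=0}^{v/u-1}(-1)^iX^{p^{ui}}$; in particular $S_u^{2u}(X)=X-X^{p^u}$. All finite fields $\mathbb{F}_{p^m}$ are regarded as subfields of a fixed algebraic closure $\overline{\mathbb{F}_p}$. Since $d\mid k$ and $l\mid k$, $L$ divides $k$, and $e\mid d$. When $p\nmid \frac{k}{L}$, $\frac{L}{k}$ denotes the inverse in $\mathbb{F}_p$ of the integer $\frac{k}{L}$ reduced mod $p$. Empty sums are $0$. *)

(* Defs.v *)
From mathcomp Require Import all_boot all_order all_algebra all_field.

Set Implicit Arguments.
Unset Strict Implicit.
Unset Printing Implicit Defensive.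

Import GRing.Theory.
Local Open Scope ring_scope.

(* Fbar : closedFieldType together with an embedding iota of 'F_p; the
   embedding also fixes the characteristic when p is prime. *)
Definition algebraic_closure_of (F : fieldType) (Fbar : closedFieldType)
    (iota : {rmorphism F -> Fbar}) : Prop :=
  forall x : Fbar, algebraicOver iota x.

(* The copy of the field with p ^ m elements inside a fixed algebraic closure,
   as the set of roots of 'X^(p ^ m) - 'X; it is a subfield with exactly p ^ m
   elements by Fpm_divring_closed and Fpm_card below. *)
Definition Fpm (Fbar : fieldType) (p m : nat) : {pred Fbar} :=
  [pred x : Fbar | x ^+ (p ^ m) == x].
Arguments Fpm : clear implicits.

(* Both are meant for 0 < u and u %| v, where %/ is exact. *)
Definition linT (R : nzRingType) (p u v : nat) : {poly R} :=
  \sum_(i < v %/ u) 'X^(p ^ (u * i)).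

Definition linS (R : nzRingType) (p u v : nat) : {poly R} :=
  \sum_(i < v %/ u) (-1) ^+ i *: 'X^(p ^ (u * i)).

Arguments linT {R} p u v.
Arguments linS {R} p u v.

(* The outer bound N.-1 stands for i <= N - 2, so the sum is empty if N = 1. *)
Definition double_sum (R : nzRingType) (p k N : nat) (b c : R) : R :=
  \sum_(0 <= i < N.-1) \sum_(i.+1 <= j < N)
     b ^+ (p ^ (k * j)) * c ^+ (p ^ (k * i)).

Lemma linS_2u (R : nzRingType) (p u : nat) :
  (0 < u)%N -> linS p u (2 * u) = 'X - 'X^(p ^ u) :> {poly R}.
Proof.
move=> u_gt0; rewrite /linS mulnK // big_ord_recl big_ord1 /=.
by rewrite muln0 expn0 expr0 scale1r expr1 scaleN1r muln1.
Qed.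

Lemma pchar_closure (p : nat) (Fbar : closedFieldType)
    (iota : {rmorphism 'F_p -> Fbar}) :
  prime p -> p \in [pchar Fbar].
Proof. by move=> p_pr; rewrite (fmorph_pchar iota) pchar_Fp. Qed.

Lemma Fpm_divring_closed (Fbar : fieldType) (p m : nat) :
  p \in [pchar Fbar] -> divring_closed (Fpm Fbar p m).
Proof.
move=> charp; have qnat: [pchar Fbar].-nat (p ^ m)%N.
  by rewrite pnatX pnatE ?(pcharf_prime charp) // charp.
split=> [|x y|x y]; rewrite !inE ?expr1n // => /eqP Dx /eqP Dy.
  by rewrite exprDn_pchar // exprNn_pchar // Dx Dy.
by rewrite exprMn exprVn Dx Dy.
Qed.

Lemma Fpm_card (Fbar : closedFieldType) (p m : nat) :
    p \in [pchar Fbar] -> (0 < m)%N ->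
  exists s : seq Fbar, [/\ uniq s, s =i Fpm Fbar p m & size s = (p ^ m)%N].
Proof.
move=> charp m_gt0; have p_pr := pcharf_prime charp.
have q_gt1 : (1 < p ^ m)%N by rewrite -(expn0 p) ltn_exp2l ?prime_gt1.
pose P : {poly Fbar} := 'X^(p ^ m) - 'X.
have szP : size P = (p ^ m).+1.
  by rewrite size_polyDl size_polyXn // size_polyN size_polyX ltnS.
have monP : P \is monic.
  by rewrite monicE lead_coefDl ?lead_coefXn // size_polyN size_polyX size_polyXn.
have [s Ds] := closed_field_poly_normal P.
rewrite (monicP monP) scale1r in Ds.
exists s; split.
- rewrite -separable_prod_XsubC -Ds separable.separable_poly.unlock derivB derivXn derivX.
  rewrite -mulr_natl natrX.
  rewrite -[p%:R]polyC_natr (pcharf0 charp) polyC0 expr0n gtn_eqF // mul0r sub0r.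
  by apply/Bezout_eq1_coprimepP; exists (0, -1); rewrite mul0r add0r mulrNN mul1r.
- move=> x; rewrite -root_prod_XsubC -Ds inE.
  by rewrite rootE !hornerE subr_eq0.
by apply: succn_inj; rewrite -szP Ds size_prod_XsubC.
Qed.

(* Main.v *)
(** Write [F^m x] for [x ^+ (p ^ m)].  On the subfield with [p ^ n] elements,
    [T_d^n] is the trace [x + F^k x + ... + F^(k(N-1)) x] with [N = n / d]
    (powers of [F^d] permuted), so by the explicit form of additive Hilbert 90 the
    double sum [y] solves [y - F^k y = c] whenever [T_d^n c = 0].  Since
    [T_l^k (y - F^l y) = y - F^k y], this produces the solution of part 1, and
    in part 2 it gives [y0] with [a - T_l^k y0] fixed by [F^l], and [T_l^k]
    is linear over the field fixed by [F^l].  Conversely,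
    [T_l^k] acts on the field with [p ^ d] elements as [k / L] times [T_e^d],
    and this is applied to [T_d^n x]. *)

Require Import Defs.
From mathcomp Require Import all_boot all_order all_algebra all_field.

Set Implicit Arguments.
Unset Strict Implicit.

Import GRing.Theory.

Local Open Scope ring_scope.

(** * Powers of Frobenius and the subfields they fix *)

Lemma exprpD (R : comNzRingType) (p m : nat) (x y : R) : p \in [pchar R] ->
  (x + y) ^+ (p ^ m) = x ^+ (p ^ m) + y ^+ (p ^ m).
Proof.
move=> charp; apply: exprDn_pchar.
by rewrite pnatX pnatE ?(pcharf_prime charp) // charp.
Qed.

Lemma exprpB (R : comNzRingType) (p m : nat) (x y : R) : p \in [pchar R] ->
  (x - y) ^+ (p ^ m) = x ^+ (p ^ m) - y ^+ (p ^ m).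
Proof. by move=> charp; apply/eqP; rewrite eq_sym subr_eq -exprpD // subrK. Qed.

Lemma exprp_sum (R : comNzRingType) (p m : nat) (I : Type) (r : seq I)
    (P : pred I) (f : I -> R) : p \in [pchar R] ->
  (\sum_(i <- r | P i) f i) ^+ (p ^ m) = \sum_(i <- r | P i) f i ^+ (p ^ m).
Proof.
move=> charp; apply: (big_morph (fun x : R => x ^+ (p ^ m))).
  by move=> x y; apply: exprpD.
by rewrite expr0n expn_eq0 eqn0Ngt (prime_gt0 (pcharf_prime charp)).
Qed.

Lemma exprp_comp (R : nzRingType) (p m1 m2 : nat) (x : R) :
  (x ^+ (p ^ m1)) ^+ (p ^ m2) = x ^+ (p ^ (m1 + m2)).
Proof. by rewrite -exprM -expnD. Qed.

Lemma FpmP (F : fieldType) (p m : nat) (x : F) :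
  reflect (x ^+ (p ^ m) = x) (x \in Fpm F p m).
Proof. by rewrite inE; apply: eqP. Qed.

Lemma Fpm_dvd (F : fieldType) (p m1 m2 : nat) (x : F) :
  (m1 %| m2)%N -> x \in Fpm F p m1 -> x \in Fpm F p m2.
Proof.
move=> /dvdnP[q ->] /FpmP Dx; apply/FpmP.
elim: q => [|q IHq]; first by rewrite mul0n expr1.
by rewrite mulSn -exprp_comp Dx.
Qed.

Lemma exprp_mod (F : fieldType) (p m i : nat) (x : F) :
  x \in Fpm F p m -> x ^+ (p ^ (i %% m)) = x ^+ (p ^ i).
Proof.
move=> xF; rewrite {2}(divn_eq i m) -exprp_comp.
by have /FpmP-> := Fpm_dvd (dvdn_mull (i %/ m) (dvdnn m)) xF.
Qed.

Lemma FpmD (F : fieldType) (p m : nat) (x y : F) : p \in [pchar F] ->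
  x \in Fpm F p m -> y \in Fpm F p m -> x + y \in Fpm F p m.
Proof. by move=> charp /FpmP Dx /FpmP Dy; apply/FpmP; rewrite exprpD // Dx Dy. Qed.

Lemma FpmB (F : fieldType) (p m : nat) (x y : F) : p \in [pchar F] ->
  x \in Fpm F p m -> y \in Fpm F p m -> x - y \in Fpm F p m.
Proof. by move=> charp /FpmP Dx /FpmP Dy; apply/FpmP; rewrite exprpB // Dx Dy. Qed.

Lemma FpmM (F : fieldType) (p m : nat) (x y : F) :
  x \in Fpm F p m -> y \in Fpm F p m -> x * y \in Fpm F p m.
Proof. by move=> /FpmP Dx /FpmP Dy; apply/FpmP; rewrite exprMn Dx Dy. Qed.

Lemma FpmX (F : fieldType) (p m i : nat) (x : F) :
  x \in Fpm F p m -> x ^+ i \in Fpm F p m.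
Proof. by move=> /FpmP Dx; apply/FpmP; rewrite exprAC Dx. Qed.

Lemma Fpm_sum (F : fieldType) (p m : nat) (I : Type) (r : seq I)
    (P : pred I) (f : I -> F) : p \in [pchar F] ->
  (forall i, P i -> f i \in Fpm F p m) ->
  \sum_(i <- r | P i) f i \in Fpm F p m.
Proof.
move=> charp fF; apply/FpmP; rewrite exprp_sum //.
by apply: eq_bigr => i /fF/FpmP.
Qed.

(** [i%:R] is a sum of ones, hence lies in the prime field and is fixed by every power of
    Frobenius. *)
Lemma Fpm_natV (F : fieldType) (p m i : nat) : p \in [pchar F] ->
  i%:R^-1 \in Fpm F p m.
Proof.
move=> charp; apply/FpmP; rewrite exprVn; congr _^-1.
by rewrite -[i]card_ord -sumr_const exprp_sum //; apply: eq_bigr => *; rewrite expr1n.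
Qed.

(** * Evaluation and composition of linearized polynomials *)

Lemma horner_linT (R : comNzRingType) (p u v : nat) (x : R) :
  (linT p u v).[x] = \sum_(i < v %/ u) x ^+ (p ^ (u * i)).
Proof. by rewrite /linT horner_sum; apply: eq_bigr => i _; rewrite hornerXn. Qed.

Lemma horner_linS2 (R : comNzRingType) (p u : nat) (x : R) : (0 < u)%N ->
  (linS p u (2 * u)).[x] = x - x ^+ (p ^ u).
Proof. by move=> u_gt0; rewrite linS_2u // !hornerE. Qed.

Lemma horner_linTD (R : comNzRingType) (p u v : nat) (x y : R) :
  p \in [pchar R] ->
  (linT p u v).[x + y] = (linT p u v).[x] + (linT p u v).[y].
Proof.
move=> charp; rewrite !horner_linT -big_split /=.
by apply: eq_bigr => i _; rewrite exprpD.
Qed.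

Lemma horner_linTB (R : comNzRingType) (p u v : nat) (x y : R) :
  p \in [pchar R] ->
  (linT p u v).[x - y] = (linT p u v).[x] - (linT p u v).[y].
Proof.
by move=> charp; apply/eqP; rewrite eq_sym subr_eq -horner_linTD // subrK.
Qed.

Lemma horner_linTZ (F : fieldType) (p u v : nat) (c x : F) :
  c \in Fpm F p u -> (linT p u v).[c * x] = c * (linT p u v).[x].
Proof.
move=> cF; rewrite !horner_linT mulr_sumr; apply: eq_bigr => i _.
by rewrite exprMn; have /FpmP-> := Fpm_dvd (dvdn_mulr i (dvdnn u)) cF.
Qed.

Lemma horner_linT_exprp (R : comNzRingType) (p u v m : nat) (x : R) :
  p \in [pchar R] -> (linT p u v).[x ^+ (p ^ m)] = (linT p u v).[x] ^+ (p ^ m).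
Proof.
move=> charp; rewrite !horner_linT exprp_sum //.
by apply: eq_bigr => i _; rewrite exprAC.
Qed.

Lemma linT_Fpm (F : fieldType) (p u v m : nat) (x : F) : p \in [pchar F] ->
  x \in Fpm F p m -> (linT p u v).[x] \in Fpm F p m.
Proof.
by move=> charp xF; rewrite horner_linT; apply: Fpm_sum => // i _; apply: FpmX.
Qed.

(** Both maps are sums of powers of one additive Frobenius, so they commute. *)
Lemma horner_linT_comp (R : comNzRingType) (p u v u' v' : nat) (x : R) :
  p \in [pchar R] ->
  (linT p u v).[(linT p u' v').[x]] = (linT p u' v').[(linT p u v).[x]].
Proof.
move=> charp; rewrite [in LHS]horner_linT [in X in _ = _.[X]]horner_linT.
rewrite [RHS]horner_linT.
under eq_bigr => i _ do rewrite horner_linT exprp_sum //.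
rewrite exchange_big; apply: eq_bigr => j _; rewrite exprp_sum //.
by apply: eq_bigr => i _; rewrite exprAC.
Qed.

Lemma linT_telescope (R : comNzRingType) (p u v : nat) (x : R) :
    p \in [pchar R] -> (u %| v)%N ->
  (linT p u v).[x - x ^+ (p ^ u)] = x - x ^+ (p ^ v).
Proof.
move=> charp /dvdnP[q ->]; rewrite horner_linT.
(* For [u = 0] also [v = 0], and both sides vanish. *)
have [->|u_gt0] := posnP u; first by rewrite muln0 expn0 expr1 subrr big_ord0.
rewrite mulnK //; elim: q => [|q IHq].
  by rewrite big_ord0 mul0n expr1 subrr.
rewrite big_ord_recr IHq /= exprpB // exprp_comp -mulnS !(mulnC u).
by rewrite addrA subrK.
Qed.

(** On the field with [p ^ m] elements, [F^c] and [F^g], with [g] the gcd, generate the same cyclic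
    group, of order dividing [m %/ g]. Each block of [m %/ g] consecutive powers of [F^c] thus sums
    to the same trace. *)
Lemma sum_exprp_gcd (F : fieldType) (p m c r : nat) (x : F) :
    (0 < m)%N -> x \in Fpm F p m ->
  \sum_(i < r * (m %/ gcdn m c)) x ^+ (p ^ (c * i))
    = (linT p (gcdn m c) m).[x] *+ r.
Proof.
move=> m_gt0 xF; set g := gcdn m c; set q := (m %/ g)%N.
have g_gt0 : (0 < g)%N by rewrite gcdn_gt0 m_gt0.
have Dm : m = (g * q)%N by rewrite mulnC divnK ?dvdn_gcdl.
have Dc : c = (g * (c %/ g))%N by rewrite mulnC divnK ?dvdn_gcdr.
have q_gt0 : (0 < q)%N by move: m_gt0; rewrite Dm muln_gt0 g_gt0.
have co_q : coprime q (c %/ g).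
  by rewrite /coprime -(eqn_pmul2r g_gt0) muln_gcdl !divnK ?dvdn_gcdl ?dvdn_gcdr ?mul1n.
elim: r => [|r IHr]; first by rewrite big_ord0.
rewrite mulSn big_split_ord /= mulrS; congr (_ + _); last first.
  (* Past the first block every exponent is shifted by [c * q], a multiple of [m = g * q], so the
     shift acts trivially on [x]. *)
  rewrite -IHr; apply: eq_bigr => i _; rewrite mulnDr -exprp_comp; congr (_ ^+ _).
  suff m_dvd : (m %| c * q)%N by have /FpmP := Fpm_dvd m_dvd xF.
  by apply/dvdnP; exists (c %/ g)%N; rewrite [in LHS]Dc [in RHS]Dm mulnCA mulnA.
rewrite horner_linT -/q.
(* Multiplication by the unit [c %/ g] permutes the residues mod [q]. *)
pose h (i : 'I_q) := Ordinal (ltn_pmod (c %/ g * i) q_gt0).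
have inj_h : injective h.
  move=> i j; wlog le_ji : i j / (j <= i)%N => [IH eq_h|].
    by case/orP: (leq_total i j) => /IH ->.
  move=> /(congr1 val) /= /eqP.
  rewrite eqn_mod_dvd ?leq_mul2l ?le_ji ?orbT // -mulnBr Gauss_dvdr //.
  by rewrite -eqn_mod_dvd // !modn_small // => /eqP/val_inj.
rewrite [RHS](reindex_inj inj_h); apply: eq_bigr => i _ /=.
by rewrite muln_modr -Dm exprp_mod // mulnA -Dc.
Qed.

(** * Explicit additive Hilbert 90 *)

Lemma sum_triangle (V : nmodType) (f : nat -> nat -> V) (N : nat) :
  \sum_(0 <= i < N.-1) \sum_(i.+1 <= j < N) f i j
    = \sum_(j < N) \sum_(i < j) f i j.
Proof.
elim: N => [|[|N] IHN]; first by rewrite big_nil big_ord0.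
  by rewrite big_nil big_ord1 big_ord0.
rewrite big_ord_recr -IHN /= big_nat_recr //= big_nat1.
rewrite [in RHS]big_ord_recr /= addrA; congr (_ + _).
rewrite -(big_mkord xpredT (fun i => f i N.+1)) -big_split /=.
by apply: eq_big_nat => i /andP[_ ltiN]; rewrite big_nat_recr //= ltnW.
Qed.

(* Summing over [j] last, with [C j] the partial sums of [c] and [b], [c]
   conjugated by powers of [F^k], the difference telescopes from [b 0 * C 0]
   to [b N * C N], both of which vanish. *)
Lemma double_sum_Hilbert90 (R : comNzRingType) (p k N : nat) (b c : R) :
    p \in [pchar R] ->
    \sum_(i < N) b ^+ (p ^ (k * i)) = 1 ->
    \sum_(i < N) c ^+ (p ^ (k * i)) = 0 ->
  double_sum p k N b c - (double_sum p k N b c) ^+ (p ^ k) = c.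
Proof.
move=> charp b1 c0; rewrite /double_sum sum_triangle.
pose B j := b ^+ (p ^ (k * j)); pose C j := \sum_(i < j) c ^+ (p ^ (k * i)).
have frC j : C j ^+ (p ^ k) = C j.+1 - c.
  rewrite /C exprp_sum // big_ord_recl muln0 expr1 addrC addKr.
  by apply: eq_bigr => i _; rewrite exprp_comp lift0 mulnS addnC.
have frB j : B j ^+ (p ^ k) = B j.+1 by rewrite /B exprp_comp mulnS addnC.
(* Frobenius applied to the normalisation of [b]: this is what makes the coefficient of [c] equal to
   1. *)
have b1S : \sum_(j < N) B j.+1 = 1.
  rewrite -[RHS](expr1n _ (p ^ k)) -b1 exprp_sum //.
  by apply: eq_bigr => j _; rewrite -frB.
under eq_bigr => j _ do rewrite -mulr_sumr.
rewrite exprp_sum //.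
under [X in _ - X]eq_bigr => j _ do rewrite exprMn -/(B j) -/(C j) frB frC mulrBr.
rewrite sumrB -mulr_suml b1S mul1r opprB addrCA -sumrB.
have -> : \sum_(j < N) (B j * C j - B j.+1 * C j.+1) = 0; last by rewrite addr0.
have -> : \sum_(j < N) (B j * C j - B j.+1 * C j.+1) = - (B N * C N - B 0 * C 0).
  rewrite -(telescope_sumr (fun j => B j * C j) (leq0n N)) -sumrN big_mkord.
  by apply: eq_bigr => j _; rewrite opprB.
by rewrite {1}/C c0 /C big_ord0 !mulr0 subrr oppr0.
Qed.

Lemma double_sum_Fpm (F : fieldType) (p k N m : nat) (b c : F) :
    p \in [pchar F] -> b \in Fpm F p m -> c \in Fpm F p m ->
  double_sum p k N b c \in Fpm F p m.
Proof.
by move=> charp bF cF; do 2![apply: Fpm_sum => // ? _]; apply: FpmM; apply: FpmX.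
Qed.

Lemma double_sum_solves (F : fieldType) (p n k : nat) (b c : F) :
    p \in [pchar F] -> (0 < n)%N ->
    b \in Fpm F p n -> c \in Fpm F p n ->
    (linT p (gcdn n k) n).[b] = 1 -> (linT p (gcdn n k) n).[c] = 0 ->
  let y := double_sum p k (n %/ gcdn n k) b c in y - y ^+ (p ^ k) = c.
Proof.
move=> charp n_gt0 bF cF b1 c0; have sumT := sum_exprp_gcd k 1 n_gt0.
by apply: double_sum_Hilbert90; rewrite // -[(n %/ _)%N]mul1n sumT.
Qed.

(** With [T] the trace and [d] the gcd, [T x - F^d (T x) = T (x - F^d x)] telescopes to
    [x - F^n x = 0]. *)
Lemma linT_gcd_Fpm (F : fieldType) (p n k : nat) (x : F) : p \in [pchar F] ->
  (0 < n)%N -> x \in Fpm F p n ->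
  (linT p (gcdn n k) n).[x] \in Fpm F p (gcdn n k).
Proof.
move=> charp n_gt0 /FpmP Dx; apply/FpmP/eqP.
rewrite -horner_linT_exprp // eq_sym -subr_eq0 -horner_linTB //.
by rewrite linT_telescope ?dvdn_gcdl // Dx subrr.
Qed.

(** Since [lcmn d l * gcdn d l = d * l], the [k %/ l] terms form exactly [k %/ lcmn d l] blocks of
    length [d %/ gcdn d l]. *)
Lemma linT_on_Fpm (F : fieldType) (p d k l : nat) (x : F) :
    (0 < d)%N -> (0 < l)%N -> (d %| k)%N -> (l %| k)%N -> x \in Fpm F p d ->
  (linT p l k).[x] = (linT p (gcdn d l) d).[x] *+ (k %/ lcmn d l).
Proof.
move=> d_gt0 l_gt0 dk lk xF; rewrite -(sum_exprp_gcd l) // horner_linT.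
have L_dvd : (lcmn d l %| k)%N by rewrite dvdn_lcm dk.
suff -> : (k %/ l = k %/ lcmn d l * (d %/ gcdn d l))%N by [].
apply/eqP; rewrite -(eqn_pmul2r l_gt0) divnK // -mulnA -[X in X == _](divnK L_dvd).
by rewrite /lcmn -divn_mulAC ?dvdn_gcdl.
Qed.


Theorem theorem4 (p : nat) (p_prime : prime p)
  (Fbar : closedFieldType) (iota : {rmorphism 'F_p -> Fbar})
  (Fbar_closure : algebraic_closure_of iota)
  (n k l : nat) (n_gt0 : (0 < n)%N) (k_gt0 : (0 < k)%N) (l_gt0 : (0 < l)%N)
  (l_dvd_k : (l %| k)%N) (a : Fbar) (aF : a \in Fpm Fbar p n) :
  let d := gcdn n k in
  let e := gcdn n l in
  let L := lcmn d l in
  forall delta delta1 : Fbar,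
  delta \in Fpm Fbar p n -> delta != 0 ->
  delta1 \in Fpm Fbar p d -> delta1 != 0 ->
  (linT p d n).[delta] = 1 ->
  (linT p e d).[delta1] = 1 ->
  ((p %| k %/ L)%N ->
     ((exists x : Fbar, x \in Fpm Fbar p n /\ (linT p l k).[x] = a)
        <-> (linT p d n).[a] = 0)
     /\
     ((linT p d n).[a] = 0 ->
        let x0 := (linS p l (2 * l)).[double_sum p k (n %/ d) delta a] in
        x0 \in Fpm Fbar p n /\ (linT p l k).[x0] = a))
  /\
  (~~ (p %| k %/ L)%N ->
     ((exists x : Fbar, x \in Fpm Fbar p n /\ (linT p l k).[x] = a)
        <-> (linS p e (2 * e) \Po linT p d n).[a] = 0)
     /\
     ((linS p e (2 * e) \Po linT p d n).[a] = 0 ->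
        let y0 := double_sum p k (n %/ d) delta (linS p l (2 * l)).[a] in
        let x0 := y0 + iota ((k %/ L)%:R^-1) * (a - (linT p l k).[y0]) * delta1
        in x0 \in Fpm Fbar p n /\ (linT p l k).[x0] = a)).
Proof.
move=> d e L delta delta1 deltaF _ delta1F _ Tdelta Tdelta1.
have charp := pchar_closure iota p_prime.
have d_gt0 : (0 < d)%N by rewrite gcdn_gt0 n_gt0.
have e_gt0 : (0 < e)%N by rewrite gcdn_gt0 n_gt0.
have De : gcdn d l = e.
  by rewrite /d -gcdnA (gcdnC k) (gcdn_idPl l_dvd_k).
have Tl x : x \in Fpm Fbar p d ->
    (linT p l k).[x] = (linT p e d).[x] *+ (k %/ L).
  by move=> xF; rewrite (linT_on_Fpm (d := d)) ?De // dvdn_gcdr.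
(* This identity yields the necessary condition in both parts. *)
have TdTl x : x \in Fpm Fbar p n -> (linT p d n).[(linT p l k).[x]]
    = (linT p e d).[(linT p d n).[x]] *+ (k %/ L).
  by move=> xF; rewrite horner_linT_comp // Tl // linT_gcd_Fpm.
split=> [p_dvd | p_ndvd].
  have solves : (linT p d n).[a] = 0 ->
      let x0 := (linS p l (2 * l)).[double_sum p k (n %/ d) delta a] in
      x0 \in Fpm Fbar p n /\ (linT p l k).[x0] = a.
    move=> Ta0; have yF := double_sum_Fpm k (n %/ d) charp deltaF aF.
    rewrite /= horner_linS2 // linT_telescope // double_sum_solves //.
    by split=> //; apply: FpmB => //; apply: FpmX.
  split=> //; split=> [[x [xF <-]] | /solves]; last by eexists; eauto.
  by rewrite TdTl // -mulr_natr; case/dvdnP: p_dvd => q ->;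
     rewrite natrM (pcharf0 charp) !mulr0.
have solves : (linS p e (2 * e) \Po linT p d n).[a] = 0 ->
    let y0 := double_sum p k (n %/ d) delta (linS p l (2 * l)).[a] in
    let x0 := y0 + iota ((k %/ L)%:R^-1) * (a - (linT p l k).[y0]) * delta1
    in x0 \in Fpm Fbar p n /\ (linT p l k).[x0] = a.
  rewrite horner_comp horner_linS2 // => /eqP; rewrite subr_eq0 eq_sym => TaE.
  (* The trace of [a] is fixed by [F^e], hence by [F^l] as [e] divides [l]; so [a - a ^+ (p ^ l)]
     has trace zero, as Hilbert 90 requires. *)
  have /FpmP TaL := Fpm_dvd (dvdn_gcdr n l) TaE.
  rewrite /= horner_linS2 //.
  have bF : a - a ^+ (p ^ l) \in Fpm Fbar p n by apply: FpmB => //; apply: FpmX.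
  set y0 := double_sum _ _ _ _ _.
  have y0F : y0 \in Fpm Fbar p n by apply: double_sum_Fpm.
  have y0E : y0 - y0 ^+ (p ^ k) = a - a ^+ (p ^ l).
    by apply: double_sum_solves => //; rewrite horner_linTB // horner_linT_exprp // TaL subrr.
  set b := a - _; rewrite fmorphV rmorph_nat.
  have bn : b \in Fpm Fbar p n by apply: FpmB => //; apply: linT_Fpm.
  (* [b - F^l b] is the difference of [a - F^l a] and [y0 - F^k y0], which agree by [y0E]. *)
  have bl : b \in Fpm Fbar p l.
    apply/FpmP/eqP; rewrite eq_sym -subr_eq0 exprpB // -horner_linT_exprp //.
    rewrite opprD addrACA -opprD -horner_linTB //.
    by rewrite linT_telescope // y0E subrr.
  have cF m : (k %/ L)%:R^-1 \in Fpm Fbar p m by apply: Fpm_natV.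
  split.
    apply: FpmD => //; apply: FpmM; first exact: FpmM.
    exact: Fpm_dvd (dvdn_gcdl n k) delta1F.
  (* The factor of [delta1] is fixed by [F^l] and comes out of [T_l^k]; the value [k %/ L] at
     [delta1] then cancels the inverse and leaves [b]. *)
  rewrite horner_linTD // horner_linTZ ?FpmM // Tl // Tdelta1.
  rewrite mulrAC mulVf ?mul1r; first by rewrite addrC subrK.
  by rewrite -(dvdn_pcharf charp).
split=> //; split=> [[x [xF <-]] | /solves]; last by eexists; eauto.
rewrite horner_comp horner_linS2 // TdTl // -mulr_natr exprMn.
(* Both this value and [k %/ L] are fixed by [F^e], so their product is killed by [S_e^{2e}]. *)
have wF : (linT p e d).[(linT p d n).[x]] \in Fpm Fbar p e.
  by rewrite -De linT_gcd_Fpm // linT_gcd_Fpm.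
have /FpmP-> := wF.
have /FpmP := Fpm_natV e (k %/ L) charp.
by rewrite exprVn => /invr_inj->; rewrite subrr.
Qed.
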